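(* Let $f : \mathcal{C}_d \to \mathbb{R}^+ \cup \{\infty\}$ be a well-defined, continuous, strictly monotone function that admits a Helly theorem and such that there is a floating body for $f$. Then $f$ admits a fractional Helly theorem. Moreover, $$F(f,d,\varepsilon) \le H(f,d,\delta^{-1}(\varepsilon)),$$ where $\delta$ is the parameter induced by the floating body for $f$; that is, the fractional Helly property for the parameter $\varepsilon$ holds with the integer $F(f,d,\varepsilon)$ at most $H(f,d,\eta)$, where $\eta = \delta^{-1}(\varepsilon)$, i.e. $\delta(\eta) = \varepsilon$.
   Context: $\mathbb{R}^+ = \{a \in \mathbb{R} : a \ge 0\}$ and $\mathcal{C}_d$ is the family of convex sets in $\mathbb{R}^d$. For a family $A$ of sets, $\bigcap A$ is the intersection of its members. A function $f : \mathcal{C}_d \to \mathbb{R}^+ \cup \{\infty\}$ is monotone if $A \subset B$ implies $f(A) \le f(B)$; it is strictly monotone if it is monotone and, for every convex set $B$ with $0 < f(B) < \infty$, if $A \subset B$ is a convex set such that the closure of $A$ is different from the closure of $B$, then $f(A) < f(B)$; it is well-defined if $f(\emptyset) = 0$ and $f(B) \in \{0,\infty\}$ for any unbounded convex set $B$. Continuity of $f$ is with respect to the topology induced by the Hausdorff metric on convex sets. $f$ admits a Helly theorem if, given $1 > \varepsilon > 0$, there is an integer $H(f,d,\varepsilon)$ such that for any finite family $\mathcal{F}$ of convex sets in $\mathbb{R}^d$ and any $\lambda > 0$, if every subfamily $\mathcal{F}'$ of cardinality at most $H(f,d,\varepsilon)$ satisfies $f(\bigcap \mathcal{F}') \ge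 \lambda$, then $f(\bigcap \mathcal{F}) \ge (1-\varepsilon)\lambda$. There is a floating body for a monotone function $f$ if for every $1 > \varepsilon > 0$ there is a $\delta = \delta(\varepsilon) > 0$ such that for any convex set $K$ with $f(K) < \infty$ there is a convex set $K(f,\varepsilon)$ such that: (i) $f(K(f,\varepsilon)) \ge (1-\delta)f(K)$, and (ii) for any convex set $A$, if $f(A \cap K) \ge (1-\varepsilon)f(K)$, then $K(f,\varepsilon) \subset A$. Moreover, it is required that $\delta(\varepsilon) \to 0$ as $\varepsilon \to 0$. $f$ admits a fractional Helly theorem if, given $1 > \varepsilon > 0$, there is an integer $F = F(f,d,\varepsilon)$ such that for any $\alpha > 0$ there is a $\beta = \beta(\alpha,f,d,\varepsilon) > 0$ such that the following holds: given any finite family $\mathcal{F}$ of convex sets in $\mathbb{R}^d$, if there are at least $\alpha\binom{|\mathcal{F}|}{F}$ subsets $A \subset \mathcal{F}$ of cardinality $F$ that satisfy $f(\bigcap A) \ge 1$, then there is a subset $\mathcal{F}' \subset \mathcal{F}$ of cardinality at least $\beta|\mathcal{F}|$ such that $f(\bigcap \mathcal{F}') \ge 1-\varepsilon$.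
   Formalization: Continuity is read as Hausdorff continuity at bounded convex sets and, at an unbounded convex set K, as convergence of f on the truncations of K by growing balls to f(K); in the fractional Helly property, only families with at least F members are considered. *)

(* Defs.v *)
From HB Require Import structures.
From mathcomp Require Import all_boot all_order all_algebra.
From mathcomp Require Import finmap.
From mathcomp Require Import all_classical all_reals all_analysis.

Set Implicit Arguments.
Unset Strict Implicit.
Unset Printing Implicit Defensive.

Import Order.TTheory GRing.Theory Num.Theory.
Import numFieldNormedType.Exports.

Local Open Scope classical_set_scope.
Local Open Scope ring_scope.
Local Open Scope ereal_scope.

Section ConvexSetFunctions.
Variables (R : realType) (d : nat).

(** R^d carries the library's sup norm.  It is equivalent to the Euclidean norm
    and enters only through closures, boundedness, truncations by large balls
    and the topology induced by the Hausdorff distance, which are the same for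
    both norms. *)
Local Notation V := 'rV[R]_d.

Definition is_convex (A : set V) : Prop :=
  convex_set (A : set (convex_lmodType V)).

Definition convex_family (F : {fset set V}) : Prop :=
  forall A, A \in F -> is_convex A.

(** The intersection of the empty family is R^d. *)
Definition inter (F : {fset set V}) : set V := \bigcap_(A in [set` F]) A.

(** A function on convex sets is a total function on [set V]; every condition
    below only involves its values on convex sets. *)
Implicit Type f : set V -> \bar R.

Definition nonneg_on_convex f : Prop := forall A, is_convex A -> 0 <= f A.

Definition monotone f : Prop :=
  forall A B, is_convex A -> is_convex B -> A `<=` B -> f A <= f B.

Definition strictly_monotone f : Prop :=
  monotone f /\
  forall B, is_convex B -> 0 < f B -> f B < +oo ->
  forall A, is_convex A -> A `<=` B -> closure A <> closure B -> f A < f B.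

Definition well_defined f : Prop :=
  f set0 = 0 /\
  forall B, is_convex B -> ~ bounded_set B -> f B = 0 \/ f B = +oo.

(** The empty set is at distance [+oo] from every nonempty set. *)
Definition hausdorff_edist (A B : set V) : \bar R :=
  ereal_inf [set r%:E | r in [set r : R |
    [/\ (0 <= r)%R,
        forall x, A x -> exists2 y, B y & (`|x - y| <= r)%R &
        forall y, B y -> exists2 x, A x & (`|x - y| <= r)%R]]].

Definition hausdorff_continuous_at f (K : set V) : Prop :=
  forall U : set (\bar R), nbhs (f K) U ->
  exists2 e : R, (0 < e)%R &
    forall L, is_convex L -> hausdorff_edist K L < e%:E -> U (f L).

(** The Hausdorff distance is a finite (pseudo)metric on the bounded nonempty
    convex sets only (already the volume is not continuous at a ray for its
    extended-valued version on all convex sets).  Continuity at a bounded set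
    refers to it; an unbounded set is the limit of its truncations. *)
Definition continuous_on_convex f : Prop :=
  (forall K, is_convex K -> bounded_set K -> hausdorff_continuous_at f K) /\
  (forall K, is_convex K -> ~ bounded_set K ->
     f (K `&` [set x | (`|x| <= r)%R]) @[r --> +oo%R] --> f K).

Definition helly_number f (eps : R) (H : nat) : Prop :=
  forall (F : {fset set V}) (lambda : R), convex_family F -> (0 < lambda)%R ->
  (forall G : {fset set V}, (G `<=` F)%fset -> (#|` G| <= H)%N ->
     lambda%:E <= f (inter G)) ->
  ((1 - eps) * lambda)%:E <= f (inter F).

Definition admits_helly f : Prop :=
  forall eps : R, (0 < eps < 1)%R -> exists H : nat, helly_number f eps H.

(** [delta] is an admissible parameter of a floating body for [f]. *)
Definition floating_body f (delta : R -> R) : Prop :=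
  (forall eps : R, (0 < eps < 1)%R ->
     (0 < delta eps)%R /\
     forall K, is_convex K -> f K < +oo ->
     exists Kf, [/\ is_convex Kf,
       (1 - delta eps)%:E * f K <= f Kf &
       forall A, is_convex A ->
         (1 - eps)%:E * f K <= f (A `&` K) -> Kf `<=` A]) /\
  (delta eps @[eps --> 0^'+] --> (0 : R))%R.

(** The condition [k <= #|` F|] excludes the families without subsets of
    cardinality [k]: they satisfy the counting hypothesis vacuously (0 >= 0),
    whereas the conclusion may fail, e.g. for [F] consisting of [set0] only. *)
Definition fractional_helly_number f (eps : R) (k : nat) : Prop :=
  forall alpha : R, (0 < alpha)%R ->
  exists2 beta : R, (0 < beta)%R &
  forall F : {fset set V}, convex_family F -> (k <= #|` F|)%N ->
  (alpha * 'C(#|` F|, k)%:R <=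
     #|` [fset G in fpowerset F | (#|` G| == k) && (1 <= f (inter G))%E]%fset|%:R
   )%R ->
  exists G : {fset set V}, [/\ (G `<=` F)%fset,
    (beta * #|` F|%:R <= #|` G|%:R)%R & (1 - eps)%:E <= f (inter G)].

Definition admits_fractional_helly f : Prop :=
  forall eps : R, (0 < eps < 1)%R ->
  exists k : nat, fractional_helly_number f eps k.

End ConvexSetFunctions.

(* Main.v *)
Require Import Defs.
From mathcomp Require Import all_boot all_order all_algebra.
From mathcomp Require Import finmap ring lra.
From mathcomp Require Import all_classical all_reals all_analysis.

(** The Helly number [H = k.+1] of [f] at [eta] serves as fractional Helly
    number at every [eps] in the unit interval with [delta eta <= eps].  Grow a
    ball centred at the origin, and for each [k]-element subfamily [B] whose
    intersection is large let [t B] be the squared radius at which the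
    truncation of [inter B] by the ball has value exactly 1.  Let [A] be a
    [k.+1]-element subfamily with [1 <= f (inter A)], and let [a] be an element
    of [A] for which [t B], where [B := A `\ a], is largest.  At that radius
    all the [k]-element subfamilies of [A] have truncated intersections of
    value at least 1, so the Helly property for [A] together with the ball
    ([helly_add_set]) says that [a] meets the truncation [K] of [inter B],
    which has value 1, in a set of value at least [1 - eta].  Consequently [a]
    contains the floating body of [K], a set of value at least [1 - delta eta]
    that depends on [B] only.  By double counting ([popular_remainder]) a
    single [B] arises in this way from a positive proportion of the sets [a],
    and all of these contain the same floating body.

    The radius exists, by the intermediate value theorem, if the value of the
    truncation varies continuously from less than 1 to at least 1
    ([exists_unit_truncation]).  Continuity for the Hausdorff metric provides
    this above the radius at which the truncation ceases to be empty.  As that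
    radius is approached from above, the truncations by Euclidean balls
    converge to a single point, so the value 1 is not skipped when [f] is
    smaller than 1 on points.

    In a space with more than one point, floating bodies prevent [f] from
    taking the value 1 at a point, so by continuity along segments [f] is
    either smaller than 1 at all points or at least 1 at all points
    ([points_dichotomy]).  In the latter case [1 <= f C] means that [C] is
    nonempty, and the theorem reduces to the classical fractional Helly
    theorem.  The argument above proves it as well: with the sets replaced by
    polytopes, [t B] is the squared distance of their intersection from the
    origin and the nearest point replaces the floating body
    ([fractional_of_large_points]). *)

Set Implicit Arguments.
Unset Strict Implicit.
Unset Printing Implicit Defensive.

Import Order.TTheory GRing.Theory Num.Theory.
Import numFieldNormedType.Exports.

Local Open Scope ring_scope.

(** * Counting subfamilies *)

Lemma card_fset_draws (T : choiceType) (F : {fset T}) (k : nat) :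
  #|` [fset G in fpowerset F | #|` G| == k]%fset| = 'C(#|` F|, k).
Proof.
pose v (Y : {set F}) := [fsetval y in Y]%fset.
have v_inj : injective v.
  move=> X Y /fsetP eqXY; apply/setP => x.
  by have := eqXY (val x); rewrite !inE.
have card_v Y : #|` v Y| = #|Y|.
  by rewrite card_imfset //= ?cardE //; exact: val_inj.
rewrite [X in 'C(X, _)](cardfE F) -card_draws.
have -> : #|[set A : {set F} | #|A| == k]| =
    #|` [fset v Y | Y in [set A : {set F} | #|A| == k]]%fset|.
  by rewrite card_imfset //= ?cardE.
congr #|` _|; apply/fsetP => G; rewrite !inE fpowersetE.
apply/andP/imfsetP => [[GF /eqP Gk]|[Y /= + ->]]; last first.
  rewrite inE card_v => Yk; split=> //.
  by apply/fsubsetP => x /in_fset_valP[].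
have GE : G = v (fsub F G) by rewrite /v fsubK.
by exists (fsub F G) => //=; rewrite inE -card_v -GE Gk.
Qed.

(** Double counting: [A |-> A `\ phi A] maps the selected [k.+1]-subsets of [F]
    to [k]-subsets, and on each fibre [phi] is injective.  Some fibre therefore
    has at least [alpha * 'C(n, k.+1) / 'C(n, k)] elements, and this is of
    order [n] because [k.+1 * 'C(n, k.+1) = (n - k) * 'C(n, k)]. *)
Lemma popular_remainder (R : realType) (T : choiceType) (F : {fset T}) (k : nat)
    (P : pred {fset T}) (phi : {fset T} -> T) (alpha : R) :
  0 < alpha -> (k < #|` F|)%N ->
  (forall A, (A `<=` F)%fset -> #|` A| = k.+1 -> P A -> phi A \in A) ->
  alpha * 'C(#|` F|, k.+1)%:R <=
    #|` [fset A in fpowerset F | (#|` A| == k.+1) && P A]%fset|%:R ->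
  exists B G : {fset T}, [/\ (G `<=` F)%fset,
    alpha / (k.+1 ^ 2)%:R * #|` F|%:R <= #|` G|%:R :> R &
    forall a, a \in G -> [/\ (a |` B `<=` F)%fset, a \notin B,
      #|` a |` B|%fset = k.+1, P (a |` B)%fset & phi (a |` B)%fset = a]].
Proof.
move=> alpha0 kF phiP.
set n := #|` F|; set AA := (X in #|` X|%:R) => cardAA.
pose BB := [fset G in fpowerset F | #|` G| == k]%fset.
pose fib B := [fset phi A | A in [fset A in AA | (A `\ phi A == B)%fset]]%fset.
have AAP A : A \in AA -> [/\ (A `<=` F)%fset, #|` A| = k.+1, P A & phi A \in A].
  rewrite !inE fpowersetE => /andP[AF /andP[/eqP Ak PA]].
  by split=> //; exact: phiP.
have cardfib B : #|` fib B| = (\sum_(A <- AA) (A `\ phi A == B)%fset)%N.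
  rewrite card_in_imfset /=; last first.
    move=> X Y /=; rewrite 2!inE => /andP[/AAP[_ _ _ phiX] /eqP XE].
    rewrite 2!inE => /andP[/AAP[_ _ _ phiY] /eqP YE] XY.
    by rewrite -(fsetD1K phiX) -(fsetD1K phiY) XE YE XY.
  by rewrite card_fset_sum1 big_fset /= -big_mkcond.
have le_sum : #|` AA| = (\sum_(B <- BB) #|` fib B|)%N.
  under eq_bigr do rewrite cardfib.
  rewrite exchange_big /= card_fset_sum1 big_seq [RHS]big_seq.
  apply: eq_bigr => A /AAP[AF Ak _ phiA].
  rewrite (big_fsetD1 (A `\ phi A)%fset) /= ?eqxx; last first.
    rewrite !inE fpowersetE (fsubset_trans (fsubsetDl _ _) AF) /=.
    by have := cardfsD1 (phi A) A; rewrite phiA Ak => -[->].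
  rewrite big_seq big1 ?addn0// => B; rewrite !inE eq_sym.
  by case: eqVneq.
have binE : ('C(n, k) * n <= (k.+1 ^ 2) * 'C(n, k.+1))%N.
  (* True because [k < n]; this is where the square of [k.+1] comes from. *)
  have n_le : (n <= k.+1 * (n - k))%N.
    rewrite -[X in (X <= _)%N](subnK (ltnW kF)) mulSn leq_add2l leq_pmulr//.
    by rewrite subn_gt0.
  by rewrite expnS expn1 -mulnA mul_bin_left mulnA mulnC leq_mul2r n_le orbT.
suff [B BBB fibB] : exists2 B, B \in BB &
    alpha / (k.+1 ^ 2)%:R * n%:R <= #|` fib B|%:R.
  exists B, (fib B); split=> //.
    apply/fsubsetP => _ /imfsetP[A /= + ->]; rewrite 2!inE => /andP[AAA _].
    by have [/fsubsetP AF _ _ phiA] := AAP _ AAA; exact: AF.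
  move=> _ /imfsetP[A /= + ->]; rewrite 2!inE => /andP[AAA /eqP BE].
  have [AF Ak PA phiA] := AAP _ AAA.
  have -> : (phi A |` B)%fset = A by rewrite -BE fsetD1K.
  by split=> //; rewrite -BE !inE eqxx.
apply: contrapT => noB.
have {}noB B : B \in BB -> #|` fib B|%:R < alpha / (k.+1 ^ 2)%:R * n%:R.
  by move=> BBB; rewrite ltNge; apply/negP => ?; apply: noB; exists B.
have cardBB : #|` BB| = 'C(n, k) by exact: card_fset_draws.
suff : #|` AA|%:R < alpha * 'C(n, k.+1)%:R by rewrite ltNge cardAA.
have binE' : alpha / (k.+1 ^ 2)%:R * n%:R * 'C(n, k)%:R <=
    alpha * 'C(n, k.+1)%:R.
  rewrite -!mulrA ler_pM2l// mulrC ler_pdivrMr ?ltr0n ?expn_gt0//.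
  by rewrite -!natrM ler_nat mulnC [leqRHS]mulnC.
apply: lt_le_trans binE'.
rewrite -cardBB le_sum (card_fset_sum1 BB) !natr_sum mulr_sumr.
rewrite big_seq [ltRHS]big_seq.
apply: ltr_sum => [|B /noB]; last by rewrite mulr1.
have : (0 < #|` BB|)%N by rewrite cardBB bin_gt0 ltnW.
by rewrite cardfs_gt0 => /fset0Pn[B BBB]; apply/hasP; exists B.
Qed.

Lemma fset_argmax (R : realType) (T : choiceType) (t : T -> R) (A : {fset T}) :
  (0 < #|` A|)%N -> exists2 a, a \in A & forall b, b \in A -> t b <= t a.
Proof.
rewrite cardfs_gt0 => /fset0Pn[a0 a0A].
have [/= a _ maxa] :=
  @Order.TotalTheory.arg_maxP _ _ A [` a0A]%fset xpredT (t \o val) isT.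
exists (val a); first exact: valP.
by move=> b bA; exact: (maxa [` bA]%fset).
Qed.

Local Open Scope classical_set_scope.
Local Open Scope ring_scope.

(** * Convex sets *)

Lemma is_convexP (R : realType) (d : nat) (A : set 'rV[R]_d) :
  is_convex A <->
  forall x y t, A x -> A y -> 0 <= t <= 1 -> A (t *: x + (1 - t) *: y).
Proof.
split=> [cA x y t Ax Ay /andP[t0 t1]|cA x y t].
  by have := cA x y (Itv01 t0 t1) (mem_set Ax) (mem_set Ay); rewrite inE.
rewrite !inE => Ax Ay; apply: cA => //.
by apply/andP; split; [exact: ge0|exact: le1].
Qed.

Section ConvexSets.
Variables (R : realType) (d : nat).
Implicit Types (x y p : 'rV[R]_d) (A C P : set 'rV[R]_d).

Lemma convex_setI A C : is_convex A -> is_convex C -> is_convex (A `&` C).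
Proof.
move=> /is_convexP cA /is_convexP cC.
apply/is_convexP => x y t [Ax Cx] [Ay Cy] t01.
by split; [exact: cA|exact: cC].
Qed.

Lemma convex_bigcap (I : Type) (D : set I) (K : I -> set 'rV[R]_d) :
  (forall i, D i -> is_convex (K i)) -> is_convex (\bigcap_(i in D) K i).
Proof.
move=> cK; apply/is_convexP => x y t Kx Ky t01 i Di.
by have /is_convexP := cK i Di; apply; [exact: Kx|exact: Ky|].
Qed.

Lemma convex_set1 x : is_convex [set x].
Proof.
apply/is_convexP => _ _ t -> -> _ /=.
by rewrite -scalerDl addrC subrK scale1r.
Qed.

Lemma convex_set0 : is_convex (set0 : set 'rV[R]_d).
Proof. by apply/is_convexP. Qed.

Lemma convex_normball (s : R) : is_convex [set x : 'rV[R]_d | `|x| <= s].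
Proof.
apply/is_convexP => x y t /= xs ys /andP[t0 t1].
have t1' : 0 <= 1 - t by rewrite subr_ge0.
apply: le_trans (ler_normD _ _) _; rewrite !normrZ !ger0_norm//.
by have := ler_wpM2l t0 xs; have := ler_wpM2l t1' ys; lra.
Qed.

End ConvexSets.

(** * Squared Euclidean norm and balls *)

Section SquaredNorm.
Variables (R : realType) (d : nat).
Implicit Types x y : 'rV[R]_d.

(** The square of the Euclidean norm.  Its strict convexity is what the sup
    norm lacks: the smallest Euclidean ball that meets a closed convex set
    meets it in one point.  Working with squares makes [sqnorm_conv] do the
    work of the triangle inequality. *)
Definition sqnorm x : R := \sum_i x ord0 i ^+ 2.

Lemma sqnorm_ge0 x : 0 <= sqnorm x.
Proof. by apply: sumr_ge0 => i _; exact: sqr_ge0. Qed.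

Lemma sqnorm_conv x y t :
  sqnorm (t *: x + (1 - t) *: y) =
  t * sqnorm x + (1 - t) * sqnorm y - t * (1 - t) * sqnorm (x - y).
Proof.
rewrite /sqnorm !mulr_sumr -big_split -sumrB /=; apply: eq_bigr => i _.
by rewrite !mxE; ring.
Qed.

Lemma norm_le_sqnorm x : `|x| ^+ 2 <= sqnorm x.
Proof.
have [->|/mx_norm_neq0[[i j] xE]] := eqVneq `|x| 0.
  by rewrite expr0n sqnorm_ge0.
have -> : `|x| = `|x i j| by exact: xE.
rewrite real_normK ?num_real// /sqnorm (bigD1 j)//= (ord1 i) lerDl.
by apply: sumr_ge0 => k _; exact: sqr_ge0.
Qed.

Lemma sqnorm_le_norm x : sqnorm x <= d%:R * `|x| ^+ 2.
Proof.
have -> : d%:R * `|x| ^+ 2 = \sum_(i < d) `|x| ^+ 2.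
  by rewrite sumr_const card_ord mulr_natl.
apply: ler_sum => i _; rewrite -[leLHS]real_normK ?num_real//.
rewrite ler_sqr ?nnegrE// [leRHS]/Num.norm /= mx_normrE.
by apply/bigmax_geP; right; exists (ord0, i).
Qed.

Lemma sqnorm_continuous : continuous sqnorm.
Proof.
apply: continuous_big => [|i _ x]; first exact: add_continuous.
have cx := @coord_continuous R 1 d ord0 i x.
exact: (cvgM cx cx).
Qed.

End SquaredNorm.

Section SquaredBalls.
Variables (R : realType) (d : nat).
Implicit Types (x y p : 'rV[R]_d) (A C : set 'rV[R]_d).

Definition sqball (r : R) : set 'rV[R]_d := [set x | sqnorm x <= r].

Lemma norm_sqball r x : sqball r x -> `|x| <= 1 + r.
Proof.
move=> xr; have := le_trans (norm_le_sqnorm x) xr; have := normr_ge0 x.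
move=> x0; have := sqr_ge0 (`|x| - 1); rewrite sqrrB1 => ? ?.
have : 0 <= `|x| * `|x| by exact: mulr_ge0.
nra.
Qed.

Lemma sqballW r1 r2 : r1 <= r2 -> sqball r1 `<=` sqball r2.
Proof. by move=> r12 x /= /le_trans; exact. Qed.

Lemma convex_sqball r : is_convex (sqball r).
Proof.
apply/is_convexP => x y t /= xr yr /andP[t0 t1]; rewrite /sqball /= sqnorm_conv.
have := sqnorm_ge0 (x - y); move: xr yr; rewrite /sqball/=.
set a := sqnorm x; set b := sqnorm y; set c := sqnorm _ => ar br c0.
have t1' : 0 <= 1 - t by rewrite subr_ge0.
have := mulr_ge0 (mulr_ge0 t0 t1') c0.
have := ler_wpM2l t0 ar; have := ler_wpM2l t1' br; lra.
Qed.

Lemma closed_sqball r : closed (sqball r).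
Proof.
have -> : sqball r = @sqnorm R d @^-1` [set s | s <= r] by [].
apply: preimage_closed (@closed_le _ r) => x _; exact: sqnorm_continuous.
Qed.

Lemma bounded_sqball r C : bounded_set (C `&` sqball r).
Proof.
exists (1 + r); split; first exact: num_real.
by move=> M rM x [_ /norm_sqball /le_trans]; apply; exact: ltW.
Qed.

Lemma closed_min_sqnorm A : closed A -> A !=set0 ->
  exists2 p, A p & forall z, A z -> sqnorm p <= sqnorm z.
Proof.
move=> clA [a Aa].
have cK : compact (A `&` sqball (sqnorm a)).
  apply: bounded_closed_compact; first exact: bounded_sqball.
  by apply: closedI => //; exact: closed_sqball.
have K0 : A `&` sqball (sqnorm a) !=set0.
  by exists a; split=> //=; rewrite /sqball /=.
have [|p] := compact_EVT_min K0 cK (f := @sqnorm R d).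
  by apply: continuous_subspaceT; exact: sqnorm_continuous.
rewrite inE => -[Ap pa] minp; exists p => // z Az.
have [za|/ltW az] := leP (sqnorm z) (sqnorm a); last exact: le_trans az.
by apply: minp; rewrite inE.
Qed.

(** The parallelogram law: two points whose squared norms barely exceed that of
    their midpoint are close. *)
Lemma sqnorm_mid x y :
  sqnorm (x - y) = 2 * sqnorm x + 2 * sqnorm y
    - 4 * sqnorm (2^-1 *: x + (1 - 2^-1) *: y).
Proof. by rewrite sqnorm_conv; field. Qed.

Lemma sqnorm_min_unique C p z : is_convex C -> C p -> C z ->
  (forall y, C y -> sqnorm p <= sqnorm y) -> sqnorm z <= sqnorm p -> z = p.
Proof.
move=> /is_convexP cC Cp Cz minp zp; apply/eqP; rewrite -subr_eq0 -normr_eq0.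
have := norm_le_sqnorm (z - p); rewrite sqnorm_mid.
have mid : C (2^-1 *: z + (1 - 2^-1) *: p) by apply: cC => //; lra.
have := minp _ mid => ? ?; have : `|z - p| ^+ 2 <= 0 by lra.
by rewrite real_exprn_even_le0 ?num_real//.
Qed.

(** Contracting [C] towards [c] by the ratio [(r1 - s) / (r2 - s)], where
    [s := sqnorm c], maps the part of [C] in the larger ball into the smaller
    one, as [sqnorm] is convex. *)
Lemma sqball_truncation C c r1 r2 :
  is_convex C -> C c -> sqnorm c < r1 -> r1 <= r2 ->
  forall x, C x -> sqball r2 x ->
  exists2 y, (C `&` sqball r1) y &
    `|x - y| <= (r2 - r1) / (r2 - sqnorm c) * `|x - c|.
Proof.
move=> /is_convexP cC Cc cr1 r12 x Cx xr2; set s := sqnorm c in cr1 *.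
pose t := (r1 - s) / (r2 - s).
have r2s : 0 < r2 - s by lra.
have t0 : 0 <= t by rewrite divr_ge0; lra.
have t1 : t <= 1 by rewrite ler_pdivrMr// mul1r; lra.
have tE : 1 - t = (r2 - r1) / (r2 - s) by rewrite /t; field; rewrite gt_eqF.
exists (t *: x + (1 - t) *: c).
  split; first by apply: cC => //; apply/andP.
  rewrite /sqball /= sqnorm_conv -/s.
  have c0 := sqnorm_ge0 (x - c).
  have t1' : 0 <= 1 - t by rewrite subr_ge0.
  have := mulr_ge0 (mulr_ge0 t0 t1') c0.
  have := ler_wpM2l t0 xr2.
  have : t * r2 + (1 - t) * s = r1 by rewrite /t; field; rewrite gt_eqF.
  lra.
rewrite -tE.
have -> : x - (t *: x + (1 - t) *: c) = (1 - t) *: (x - c).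
  by apply/rowP => i; rewrite !mxE; ring.
by rewrite normrZ ger0_norm// subr_ge0.
Qed.

End SquaredBalls.

(** * Polytopes *)

Section Polytopes.
Variables (R : realType) (d : nat).
Implicit Types (x : 'rV[R]_d) (A P : set 'rV[R]_d).

Lemma convex_cone_hull x P : is_convex P ->
  is_convex [set tz.1 *: x + (1 - tz.1) *: tz.2 | tz in `[0, 1] `*` P].
Proof.
move=> /is_convexP cP; apply/is_convexP.
move=> _ _ l [[t y] [/= tI Py] <-] [[t' y'] [/= t'I Py'] <-] /andP[l0 l1].
rewrite !in_itv/= in tI t'I; case/andP: tI => t0 t1; case/andP: t'I => t'0 t'1.
pose a := l * (1 - t); pose b := (1 - l) * (1 - t').
have a0 : 0 <= a by rewrite mulr_ge0// subr_ge0.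
have b0 : 0 <= b by rewrite mulr_ge0// subr_ge0.
have abE : l * t + (1 - l) * t' = 1 - (a + b) by rewrite /a /b; ring.
have T0 : 0 <= l * t + (1 - l) * t' by rewrite addr_ge0// mulr_ge0// subr_ge0.
(* The two base points merge into their weighted mean, if they have weight. *)
have [z Pz zE] : exists2 z, P z & a *: y + b *: y' = (a + b) *: z.
  have [ab0|ab_neq0] := eqVneq (a + b) 0.
    have [-> ->] : a = 0 /\ b = 0 by split; lra.
    by exists y => //; rewrite addr0 !scale0r addr0.
  exists ((a / (a + b)) *: y + (1 - a / (a + b)) *: y').
    have ab_gt0 : 0 < a + b by rewrite lt_neqAle eq_sym ab_neq0 addr_ge0.
    apply: cP => //; apply/andP; split; first by rewrite divr_ge0// ltW.
    by rewrite ler_pdivrMr// mul1r lerDl.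
  by apply/rowP => i; rewrite !mxE; field.
exists (1 - (a + b), z).
  split => //=; rewrite in_itv/=; apply/andP; split; first by rewrite -abE.
  by rewrite gerBl addr_ge0.
rewrite /= subKr -abE -zE /a /b; apply/rowP => i; rewrite !mxE; ring.
Qed.

(** The convex hull of finitely many points, built by adding one point at a
    time: the cone with apex [x] over a compact convex set is a continuous
    image of a compact set. *)
Lemma exists_polytope (s : seq 'rV[R]_d) :
  exists P, [/\ compact P, is_convex P, forall x, x \in s -> P x &
    forall A, is_convex A -> (forall x, x \in s -> A x) -> P `<=` A].
Proof.
elim: s => [|x s [P [compP cP sP PA]]].
  exists set0; split.
  - exact: compact0.
  - exact: convex_set0.
  - by move=> x; rewrite in_nil.
  - by move=> A _ _; exact: sub0set.
have [P0|/set0P[z Pz]] := eqVneq P set0.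
  exists [set x]; split.
  - exact: compact_set1.
  - exact: convex_set1.
  - by move=> y; rewrite in_cons => /orP[/eqP//|/sP]; rewrite P0.
  - by move=> A _ sA _ ->; apply: sA; exact: mem_head.
exists [set tz.1 *: x + (1 - tz.1) *: tz.2 | tz in `[0, 1] `*` P]; split.
- apply: continuous_compact.
    apply: continuous_subspaceT => tz.
    apply: cvgD; apply: cvgZ.
    + exact: cvg_fst.
    + exact: cvg_cst.
    + by apply: cvgB; [exact: cvg_cst|exact: cvg_fst].
    + exact: cvg_snd.
  by apply: compact_setX => //; exact: segment_compact.
- exact: convex_cone_hull.
- move=> y; rewrite in_cons => /orP[/eqP ->|/sP Py].
    exists (1, z); first by split=> //=; rewrite in_itv/= ler01 lexx.
    by rewrite /= subrr scale0r addr0 scale1r.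
  exists (0, y); first by split=> //=; rewrite in_itv/= ler01 lexx.
  by rewrite /= subr0 scale0r add0r scale1r.
move=> A cA sA _ [[t y] [/= tI Py] <-].
move/is_convexP: (cA); apply; [by apply: sA; exact: mem_head| |].
  by apply: (PA A) => // w ws; apply: sA; rewrite in_cons ws orbT.
by rewrite in_itv/= in tI.
Qed.

End Polytopes.

(** * Values of truncations by balls *)

(** If [g] avoided [v], the indicator function of [v <= g] would be locally
    constant, hence continuous, and the real intermediate value theorem would
    give it the value 1/2. *)
Lemma IVT_ereal (R : realType) (g : R -> \bar R) (a b : R) (v : \bar R) :
  a <= b -> (forall x, a <= x <= b -> {for x, continuous g}) ->
  (g a < v <= g b)%E -> exists2 c, a <= c <= b & g c = v.
Proof.
move=> ab gc /andP[gav vgb]; apply: contrapT => gNv.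
pose h x : R := if (g x < v)%E then 0 else 1.
have gv x : a <= x <= b -> (g x < v)%E \/ (v < g x)%E.
  move=> xab; have [|/ltW|gxv] := ltgtP (g x) v; [by left|by right|].
  by exfalso; apply: gNv; exists x.
have hc : {within `[a, b], continuous h}.
  apply: continuous_in_subspaceT => x; rewrite inE /= in_itv /= => xab.
  have hx_near : \forall y \near x, h y = h x.
    have [gxv|gxv] := gv x xab; rewrite /h.
      have : \forall y \near x, (g y < v)%E.
        by apply: (gc x xab [set y | (y < v)%E]); exact: open_ereal_lt'.
      by apply: filterS => y gyv; rewrite gxv gyv.
    have : \forall y \near x, (v < g y)%E.
      by apply: (gc x xab [set y | (v < y)%E]); exact: open_ereal_gt'.
    by apply: filterS => y gyv; rewrite !ltNge (ltW gxv) (ltW gyv).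
  by move: hx_near => /cvg_near_cst; exact.
have [|c _] := @IVT _ h a b 2^-1 ab hc.
  rewrite /h gav ltNge vgb /=.
  by apply/andP; split; rewrite ?ge_min ?le_max; apply/orP; [left|right]; lra.
by rewrite /h; case: ifP => _; lra.
Qed.

Lemma hausdorff_lt (R : realType) (d : nat) (A B : set 'rV[R]_d) (r e : R) :
  0 <= r -> r < e ->
  (forall x, A x -> exists2 y, B y & `|x - y| <= r) ->
  (forall y, B y -> exists2 x, A x & `|x - y| <= r) ->
  (hausdorff_edist A B < e%:E)%E.
Proof.
move=> r0 re AB BA; apply: (@le_lt_trans _ _ r%:E); last by rewrite lte_fin.
by apply: ereal_inf_lbound; exists r.
Qed.

Lemma continuous_axpy (R : realType) (d : nat) (x : 'rV[R]_d) (a b : R) :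
  continuous (fun z : 'rV[R]_d => a *: x + b *: z).
Proof.
move=> z; apply: (@cvgD _ _ _ (nbhs z) (nbhs_filter z)).
  exact: (@cvg_cst _ _ _ (nbhs z) (nbhs_filter z)).
apply: (@cvgZ _ _ _ (nbhs z) (nbhs_filter z)); last exact: cvg_id.
exact: (@cvg_cst _ _ _ (nbhs z) (nbhs_filter z)).
Qed.

(** The requirement on floating bodies at one value [eta] of the parameter,
    with [D] for [delta eta]. *)
Definition has_floating_bodies (R : realType) (d : nat)
    (f : set 'rV[R]_d -> \bar R) (eta D : R) : Prop :=
  forall K, is_convex K -> (f K < +oo)%E -> exists Kf, [/\ is_convex Kf,
    ((1 - D)%:E * f K <= f Kf)%E &
    forall A, is_convex A -> ((1 - eta)%:E * f K <= f (A `&` K))%E ->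
      Kf `<=` A].

Section Truncations.
Variables (R : realType) (d : nat) (f : set 'rV[R]_d -> \bar R).
Hypotheses (f_wd : well_defined f) (f_mono : Defs.monotone f)
  (f_cont : continuous_on_convex f).
Implicit Types (x y p : 'rV[R]_d) (A C P : set 'rV[R]_d).

Lemma convex_truncation C r : is_convex C -> is_convex (C `&` sqball r).
Proof. by move=> cC; apply: convex_setI => //; exact: convex_sqball. Qed.

Lemma bounded_set1 x : bounded_set [set x].
Proof.
exists `|x|; split; first exact: num_real.
by move=> M xM _ ->; exact: ltW.
Qed.

(** The points of the larger truncation are at distance at most [M] from [c],
    and [sqball_truncation] moves them by at most the fraction
    [(s - r) / (r - sqnorm c)] of that distance. *)
Lemma hausdorff_truncation C c r s M : is_convex C -> C c ->
  sqnorm c < r -> r <= s -> (forall x, C x -> sqball s x -> `|x - c| <= M) ->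
  forall e, (s - r) / (r - sqnorm c) * M < e ->
  (hausdorff_edist (C `&` sqball r) (C `&` sqball s) < e%:E)%E /\
  (hausdorff_edist (C `&` sqball s) (C `&` sqball r) < e%:E)%E.
Proof.
move=> cC Cc cr rs CM e lte; set q := sqnorm c in cr lte *.
have rq : 0 < r - q by rewrite subr_gt0.
have sr : 0 <= s - r by rewrite subr_ge0.
have M0 : 0 <= M.
  by apply: le_trans (CM c Cc _) => //; rewrite /sqball/= -/q; lra.
have down x : (C `&` sqball s) x ->
    exists2 y, (C `&` sqball r) y & `|x - y| <= (s - r) / (r - q) * M.
  move=> [Cx xs]; have [y Cy xy] := sqball_truncation cC Cc cr rs Cx xs.
  rewrite -/q in xy; exists y => //; apply: le_trans xy _; apply: ler_pM => //.
  - by rewrite divr_ge0// subr_ge0; lra.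
  - by apply: ler_wpM2l => //; rewrite lef_pV2 ?posrE; lra.
  - exact: CM.
have up x : (C `&` sqball r) x ->
    exists2 y, (C `&` sqball s) y & `|x - y| <= (s - r) / (r - q) * M.
  move=> [Cx xr]; exists x; first by split=> //; exact: sqballW xr.
  by rewrite subrr normr0 mulr_ge0// divr_ge0// ltW.
split; apply: hausdorff_lt lte _ _ => //;
  do ?by rewrite mulr_ge0// divr_ge0// ltW.
- by move=> y /down[x ? ?]; exists x => //; rewrite distrC.
- by move=> y /up[x ? ?]; exists x => //; rewrite distrC.
Qed.

(** The radius has to exceed the least one at which [C] is met: there the
    truncation jumps from the empty set to a nonempty one. *)
Lemma continuous_truncation C c r : is_convex C -> C c -> sqnorm c < r ->
  {for r, continuous (fun s => f (C `&` sqball s))}.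
Proof.
move=> cC Cc cr; set q := sqnorm c in cr.
have q0 : 0 <= q by exact: sqnorm_ge0.
have bC := @bounded_sqball _ _ r C.
move=> U /(f_cont.1 _ (convex_truncation cC) bC)[e e0 eU].
(* [M] bounds the diameter of the truncation at every radius up to [r + 1]. *)
pose M := 2 * (2 + r); pose D := (r - q) / 2.
have D0 : 0 < D by rewrite /D; lra.
have M0 : 0 < M by rewrite /M; lra.
have CM s x : s <= r + 1 -> C x -> sqball s x -> `|x - c| <= M.
  move=> sr _ /norm_sqball xs; have /norm_sqball cs : sqball r c by exact: ltW.
  by apply: le_trans (ler_normB _ _) _; rewrite /M; lra.
have dU : \forall s \near r, `|r - s| < Num.min (Num.min 1 D) (e * D / M).
  apply/nbhs_ballP; exists (Num.min (Num.min 1 D) (e * D / M)) => //=.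
  by rewrite !lt_min ltr01 D0 divr_gt0// mulr_gt0.
have {}dU : \forall s \near r, U (f (C `&` sqball s)); last exact: dU.
apply: filterS dU => s; rewrite !lt_min => /andP[/andP[rs1 rsD] rse].
apply: eU; first exact: convex_truncation.
have close a b : q + D <= a -> a <= b -> b - a = `|r - s| ->
    (b - a) / (a - q) * M < e.
  move=> qa ab ->; rewrite -ltr_pdivlMr// ltr_pdivrMr; last by lra.
  apply: lt_le_trans rse _; rewrite mulrAC ler_pM2l ?divr_gt0//; lra.
have [sr|/ltW rs] := leP r s.
  have sr1 : s <= r + 1 by move: rs1; rewrite distrC ger0_norm; lra.
  have lte : (s - r) / (r - q) * M < e.
    apply: close => //; first by rewrite /D; lra.
    by rewrite distrC ger0_norm// subr_ge0.
  by have [] := hausdorff_truncation cC Cc cr sr (fun x => @CM s x sr1) lte.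
have rsE : `|r - s| = r - s by rewrite ger0_norm// subr_ge0.
have qs : q + D <= s by move: rsD; rewrite rsE /D; lra.
have cs : sqnorm c < s by rewrite -/q; lra.
have rr1 : r <= r + 1 by lra.
have lte : (r - s) / (s - q) * M < e by exact: close.
by have [] := hausdorff_truncation cC Cc cs rs (fun x => @CM r x rr1) lte.
Qed.

(** If [C] is unbounded, [f C] is infinite since it is not 0, and it is the
    limit of the values at the truncations. *)
Lemma exists_large_truncation C : is_convex C -> (1 <= f C)%E ->
  exists r, (1 <= f (C `&` sqball r))%E.
Proof.
move=> cC fC.
have ballE (s : R) :
    C `&` [set x | `|x| <= s] `<=` C `&` sqball (d%:R * s ^+ 2).
  move=> x [Cx xs]; split=> //; apply: le_trans (sqnorm_le_norm x) _.
  by rewrite ler_wpM2l// ler_sqr ?nnegrE// (le_trans _ xs).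
have [bC|ubC] := pselect (bounded_set C).
  case: bC => M [_ CM]; exists (d%:R * (M + 1) ^+ 2).
  rewrite (_ : C `&` _ = C)//; apply/seteqP; split=> [x []//|x Cx].
  by apply: ballE; split=> //=; apply: CM => //; rewrite ltrDl.
have fCoo : f C = +oo%E.
  by have [fC0|//] := f_wd.2 _ cC ubC; move: fC; rewrite fC0 lee_fin ler10.
have foo := f_cont.2 _ cC ubC; rewrite fCoo in foo.
have : \forall s \near +oo%R, (1 < f (C `&` [set x | (`|x| <= s)%R]))%E.
  by apply: (foo [set y | (1 < y)%E]); apply: open_ereal_gt'; exact: ltry.
case/filter_ex => s /ltW fs.
exists (d%:R * s ^+ 2); apply: le_trans fs _; apply: f_mono => //.
  by apply: convex_setI => //; exact: convex_normball.
exact: convex_truncation.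
Qed.

(** By the parallelogram law, the truncations of [C] at radii decreasing to the
    least squared norm on the closure of [C] converge to the point where it is
    attained. *)
Lemma exists_small_truncation C : (forall p, (f [set p] < 1)%E) ->
  is_convex C -> C !=set0 ->
  exists c r, [/\ C c, sqnorm c < r & (f (C `&` sqball r) < 1)%E].
Proof.
move=> fp cC [z0 Cz0].
have [p clp minp] : exists2 p : 'rV[R]_d, closure C p &
    forall z : 'rV[R]_d, closure C z -> sqnorm p <= sqnorm z.
  apply: closed_min_sqnorm; first exact: closed_closure.
  by exists z0; exact: subset_closure.
have [e e0 eU] :=
  f_cont.1 _ (@convex_set1 R d p) (@bounded_set1 p) _ (open_ereal_lt' (fp p)).
pose rho := e / 2; pose r := sqnorm p + rho ^+ 2 / 2.
have rho0 : 0 < rho by rewrite /rho; lra.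
have pr : sqnorm p < r by rewrite ltrDl divr_gt0// exprn_gt0.
have [c [Cc cr]] : exists c, C c /\ sqnorm c < r.
  have /clp[c [Cc cr]] : nbhs p [set x | sqnorm x < r].
    exact: (@sqnorm_continuous R d p _ (lt_nbhsl pr)).
  by exists c.
exists c, r; split=> //; apply: eU; first exact: convex_truncation.
have near_p x : (C `&` sqball r) x -> `|x - p| <= rho.
  move=> [Cx xr]; rewrite -(@ler_sqr _ `|x - p|) ?nnegrE ?(ltW rho0)//.
  apply: le_trans (norm_le_sqnorm _) _; rewrite sqnorm_mid.
  have midC : closure C (2^-1 *: x + (1 - 2^-1) *: p).
    move=> W /(@continuous_axpy R d x _ _ p)/clp[z [Cz Wz]].
    exists (2^-1 *: x + (1 - 2^-1) *: z); split=> //.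
    by move/is_convexP: cC; apply=> //; lra.
  have := minp _ midC; move: xr; rewrite /sqball/= /r; lra.
apply: (@hausdorff_lt _ _ _ _ rho); [exact: ltW|by rewrite /rho; lra| |].
  move=> _ ->; exists c; first by split=> //; exact: ltW.
  by rewrite distrC near_p//; split=> //; exact: ltW.
by move=> y /near_p yp; exists p => //; rewrite distrC.
Qed.

Lemma exists_unit_truncation C : (forall p, (f [set p] < 1)%E) ->
  is_convex C -> (1 <= f C)%E -> exists t, f (C `&` sqball t) = 1%E.
Proof.
move=> fp cC fC.
have C0 : C !=set0.
  by apply/set0P/eqP => C0; move: fC; rewrite C0 f_wd.1 lee_fin ler10.
have [c [a [Cc ca fa]]] := exists_small_truncation fp cC C0.
have [b fb] := exists_large_truncation cC fC.
have ab : a <= b.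
  rewrite leNgt; apply/negP => /ltW ba.
  suff : (1 < (1 : \bar R))%E by rewrite ltxx.
  apply: le_lt_trans fa; apply: le_trans fb _; apply: f_mono.
  - exact: convex_truncation.
  - exact: convex_truncation.
  - by move=> x [Cx /(sqballW ba)].
have [||t _ ft] := @IVT_ereal _ (fun s => f (C `&` sqball s)) a b 1%E ab.
- move=> x /andP[ax _]; apply: continuous_truncation cC Cc _.
  exact: lt_le_trans ax.
- by rewrite fa fb.
by exists t.
Qed.

(** Otherwise, by continuity, [f] takes the value 1 at some point [z].  Then a
    short enough segment [K] from [z] to [z'] has nearly the same value as each
    of its endpoints, so a floating body of [K] would lie in the intersection
    of the singletons of [z] and [z'], which is empty. *)
Lemma points_dichotomy (eta D : R) : 0 < eta < 1 -> D < 1 ->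
  has_floating_bodies f eta D ->
  (forall p, (1 <= f [set p])%E) \/ (forall p, (f [set p] < 1)%E).
Proof.
move=> /andP[eta0 eta1] D1 float; apply: contrapT.
move=> /not_orP[/existsNP[p /negP +] /existsNP[p' /negP +]].
rewrite -ltNge -leNgt => fp fp'.
pose u : 'rV[R]_d := p' - p.
have u0 : u != 0.
  by rewrite subr_eq0; apply/eqP => pp; move: fp'; rewrite pp leNgt fp.
pose pt (s : R) : 'rV[R]_d := p + s *: u.
have ptc (x : R) : {for x, continuous (fun s => f [set pt s])}.
  move=> U /(f_cont.1 _ (@convex_set1 R d _) (@bounded_set1 _))[e e0 eU].
  have pt_cont : pt s @[s --> x] --> pt x.
    apply: cvgD; first exact: cvg_cst.
    by apply: cvgZ; [exact: cvg_id|exact: cvg_cst].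
  have : \forall s \near x, `|pt x - pt s| < e.
    by move/cvgrPdist_lt : pt_cont; exact.
  apply: filterS => s se; apply: eU; first exact: convex_set1.
  by apply: hausdorff_lt se _ _ => // _ ->; [exists (pt s)|exists (pt x)].
have [||a _ fa] := @IVT_ereal _ (fun s => f [set pt s]) 0 1 1%E ler01.
- by move=> x _; exact: ptc.
- by rewrite /pt scale0r addr0 fp scale1r /u addrC subrK fp'.
pose z := pt a.
pose seg (s : R) := [set z + l *: u | l in `[0, s]].
have cseg s : is_convex (seg s).
  apply/is_convexP => _ _ t [l /= + <-] [l' /= + <-] /andP[t0 t1].
  rewrite !in_itv/= => /andP[l0 ls] /andP[l'0 l's].
  exists (t * l + (1 - t) * l'); last by apply/rowP => i; rewrite !mxE; ring.
  have t1' : 0 <= 1 - t by rewrite subr_ge0.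
  rewrite /= in_itv/=; apply/andP; split; first by rewrite addr_ge0// mulr_ge0.
  by have := ler_wpM2l t0 ls; have := ler_wpM2l t1' l's; lra.
(* The bounds satisfy [(1 - eta) * (1 + eta / 2) <= 1 - eta / 2]. *)
have nbhs1 : nbhs (f [set z])
    ([set y | (y < (1 + eta / 2)%:E)%E] `&` [set y | ((1 - eta / 2)%:E < y)%E]).
  rewrite fa; apply: filterI.
    by apply: open_ereal_lt'; rewrite lte_fin; lra.
  by apply: open_ereal_gt'; rewrite lte_fin; lra.
have [e e0 eU] := f_cont.1 _ (@convex_set1 R d z) (@bounded_set1 z) _ nbhs1.
have nu0 : 0 < `|u| by rewrite normr_gt0.
pose s := e / 2 / `|u|.
have s0 : 0 < s by rewrite !divr_gt0.
have su : s * `|u| = e / 2 by rewrite /s divfK// gt_eqF.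
have [fK1 fK2] :
    (f (seg s) < (1 + eta / 2)%:E)%E /\ ((1 - eta / 2)%:E < f (seg s))%E.
  apply: eU => //; apply: (@hausdorff_lt _ _ _ _ (e / 2)); [lra|lra| |].
    move=> _ ->; exists z; last by rewrite subrr normr0; lra.
    by exists 0; rewrite ?scale0r ?addr0//= in_itv/= lexx ltW.
  move=> _ [l /= + <-]; rewrite in_itv/= => /andP[l0 ls]; exists z => //.
  rewrite opprD addrA subrr sub0r normrN normrZ ger0_norm// -su.
  by rewrite ler_pM2r.
pose z' := z + s *: u.
have fz' : ((1 - eta / 2)%:E < f [set z'])%E.
  apply: (eU _ _ _).2; first exact: convex_set1.
  apply: (@hausdorff_lt _ _ _ _ (e / 2)); [lra|lra| |].
    move=> _ ->; exists z' => //.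
    by rewrite opprD addrA subrr sub0r normrN normrZ gtr0_norm// su.
  move=> _ ->; exists z => //.
  by rewrite opprD addrA subrr sub0r normrN normrZ gtr0_norm// su.
have [Kf [cKf fKf Kfsub]] := float _ (cseg s) (lt_trans fK1 (ltry _)).
have etaK : ((1 - eta)%:E * f (seg s) <= (1 - eta / 2)%:E)%E.
  have [k kE] : exists k, f (seg s) = k%:E.
    by case: (f (seg s)) fK1 fK2 => // k _ _; exists k.
  rewrite kE in fK1 *; move: fK1; rewrite lte_fin -EFinM lee_fin => k1; nra.
have Kf0 : Kf = set0.
  apply/seteqP; split=> // w Kfw.
  have wz : w = z.
    apply: (Kfsub [set z]) => //; first exact: convex_set1.
    have -> : [set z] `&` seg s = [set z].
      apply/seteqP; split=> [x []//|_ ->]; split=> //.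
      by exists 0; rewrite ?scale0r ?addr0//= in_itv/= lexx ltW.
    by rewrite fa; apply: le_trans etaK _; rewrite lee_fin; lra.
  have wz' : w = z'.
    apply: (Kfsub [set z']) => //; first exact: convex_set1.
    have -> : [set z'] `&` seg s = [set z'].
      apply/seteqP; split=> [x []//|_ ->]; split=> //.
      by exists s => //=; rewrite in_itv/= lexx ltW.
    by apply: le_trans etaK (ltW fz').
  have /eqP : s *: u = 0 by apply: (addrI z); rewrite addr0 -/z' -wz' wz.
  by rewrite scaler_eq0 (negbTE u0) orbF gt_eqF.
suff : (0 < f Kf)%E by rewrite Kf0 f_wd.1 ltxx.
apply: lt_le_trans fKf; rewrite mule_gt0// ?lte_fin ?subr_gt0//.
by apply: lt_trans fK2; rewrite lte_fin; lra.
Qed.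

End Truncations.

(** * From the Helly property to pivotal sets *)

Section Helly.
Variables (R : realType) (d : nat) (f : set 'rV[R]_d -> \bar R).
Hypothesis f_mono : Defs.monotone f.
Implicit Types (F B A : {fset set 'rV[R]_d}) (a b C Z : set 'rV[R]_d).

(** Helly for the [k.+1] sets [h i] together with [D], at [lambda = 1]: a
    subfamily of size at most [k.+1] that contains [D] has room for only [k]
    sets among the [h i], so it misses the index of one of them.  The sets are
    indexed because they need not be distinct. *)
Lemma helly_add_set (T : choiceType) (h : T -> set 'rV[R]_d) (I : {fset T}) D
    (eta : R) (k : nat) :
  helly_number f eta k.+1 -> #|` I| = k.+1 ->
  (forall i, i \in I -> is_convex (h i)) -> is_convex D ->
  (1 <= f (\bigcap_(i in [set` I]) h i))%E ->
  (forall j, j \in I ->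
    (1 <= f ((\bigcap_(i in [set` I `\ j]%fset) h i) `&` D))%E) ->
  ((1 - eta)%:E <= f ((\bigcap_(i in [set` I]) h i) `&` D))%E.
Proof.
move=> fH Ik ch cD fI fID; pose F := (D |` (h @` I))%fset.
have cF : convex_family F.
  by move=> X; rewrite !inE => /orP[/eqP ->//|/imfsetP[i /= iI ->]]; exact: ch.
have cI J : (J `<=` I)%fset -> is_convex (\bigcap_(i in [set` J]) h i).
  by move=> /fsubsetP JI; apply: convex_bigcap => i /= /JI /ch.
have cG G : (G `<=` F)%fset -> is_convex (inter G).
  by move=> /fsubsetP GF; apply: convex_bigcap => X /= /GF /cF.
have -> : (\bigcap_(i in [set` I]) h i) `&` D = inter F.
  apply/seteqP; split=> x.
    move=> [xI xD] X /=; rewrite !inE => /orP[/eqP ->//|/imfsetP[i /= iI ->]].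
    exact: xI.
  move=> xF; split=> [i /= iI|]; apply: xF => /=.
    by rewrite !inE in_imfset ?orbT.
  by rewrite !inE eqxx.
rewrite -[X in (X%:E <= _)%E]mulr1; apply: fH => // G GF Gk.
have [GI|GI] := boolP (G `<=` h @` I)%fset.
  apply: le_trans fI _; apply: f_mono; [exact: cI|exact: cG|].
  by move=> x xI X /= /(fsubsetP GI)/imfsetP[i /= iI ->]; exact: xI.
have DG : D \in G.
  move: GI; apply: contraNT => DG; apply/fsubsetP => X XG.
  have := fsubsetP GF _ XG; rewrite !inE => /orP[/eqP XD|//].
  by move: DG; rewrite -XD XG.
have [i0 i0I] : exists i, i \in I by apply/fset0Pn; rewrite -cardfs_gt0 Ik.
have [g gP] : {g : set 'rV[R]_d -> T & forall X, X \in (h @` I)%fset ->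
    g X \in I /\ h (g X) = X}.
  apply: (@choice _ _ (fun X i =>
    X \in (h @` I)%fset -> i \in I /\ h i = X)) => X.
  have [/imfsetP[i /= iI ->]|_] := boolP (X \in (h @` I)%fset).
    by exists i.
  by exists i0.
pose J := (g @` (G `\ D))%fset.
have [j jI jJ] : exists2 j, j \in I & j \notin J.
  apply: contrapT => noj.
  have : (I `<=` J)%fset.
    apply/fsubsetP => j jI; apply: contrapT => /negP jJ.
    by apply: noj; exists j.
  move=> /fsubset_leq_card; rewrite Ik leqNgt ltnS => /negP; apply.
  apply: leq_trans (leq_imfset_card _ _ _) _ => /=.
  by move: Gk; rewrite (cardfsD1 D G) DG.
apply: le_trans (fID _ jI) _; apply: f_mono; [|exact: cG|].
  by apply: convex_setI => //; apply: cI; exact: fsubsetDl.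
move=> x [xI xD] X /= XG; have [->//|XD] := eqVneq X D.
have /gP[gI <-] : X \in (h @` I)%fset.
  by have := fsubsetP GF _ XG; rewrite !inE (negbTE XD).
apply: xI => /=; rewrite !inE gI andbT; apply: contra jJ => /eqP <-.
by apply: in_imfset => /=; rewrite !inE XD.
Qed.

(** In the applications [t B'] is the squared radius at which a ball growing
    around the origin has captured enough of [inter B'].  By the last
    condition, once the ball has captured enough of [inter B] it has captured
    enough of the intersection of [a |` B] without any one of its sets. *)
Definition pivotal k F (t : {fset set 'rV[R]_d} -> R) B a : Prop :=
  [/\ (a |` B `<=` F)%fset, #|` a |` B|%fset = k.+1,
    (1 <= f (inter (a |` B)%fset))%E, a \notin B &
    forall b, b \in (a |` B)%fset -> t ((a |` B) `\ b)%fset <= t B].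

(** By [popular_remainder], applied to a choice in each subfamily of an element
    whose removal maximizes [t], a positive proportion of the sets of [F] is
    pivotal over one common [B]; it remains to find one large set inside all of
    them. *)
Lemma fractional_of_pivotal k (eps : R) :
  (forall F, convex_family F -> exists t, forall B a0, pivotal k F t B a0 ->
    exists Z, [/\ is_convex Z, ((1 - eps)%:E <= f Z)%E &
      forall a, pivotal k F t B a -> Z `<=` a]) ->
  fractional_helly_number f eps k.+1.
Proof.
move=> tP alpha alpha0; exists (alpha / (k.+1 ^ 2)%:R).
  by rewrite divr_gt0// ltr0n expn_gt0.
move=> F cF kF cardF; have [t {}tP] := tP F cF.
have [phi phiP] : {phi : {fset set 'rV[R]_d} -> set 'rV[R]_d & forall A,
    (0 < #|` A|)%N -> phi A \in A /\
    forall b, b \in A -> t (A `\ b)%fset <= t (A `\ phi A)%fset}.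
  apply: (@choice _ _ (fun A a => (0 < #|` A|)%N -> a \in A /\
    forall b, b \in A -> t (A `\ b)%fset <= t (A `\ a)%fset)) => A.
  have [A0|_] := boolP (0 < #|` A|)%N; last by exists set0.
  by have [a aA maxa] := fset_argmax (fun b => t (A `\ b)%fset) A0; exists a.
have [|B [G [GF cardG GP]]] := popular_remainder alpha0 kF _ cardF (phi := phi).
  by move=> A _ Ak _; apply: (phiP A _).1; rewrite Ak.
have Gpiv a : a \in G -> pivotal k F t B a.
  move=> /GP[aBF aB aBk faB phia]; split=> //.
  have [|_] := phiP (a |` B)%fset; first by rewrite aBk.
  by rewrite phia fsetU1K.
have [a0 a0G] : exists a, a \in G.
  apply/fset0Pn; rewrite -cardfs_gt0 -(@ltr0n R); apply: lt_le_trans cardG.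
  by rewrite !mulr_gt0 ?invr_gt0 ?ltr0n ?expn_gt0// (leq_trans _ kF).
have [Z [cZ fZ ZP]] := tP _ _ (Gpiv _ a0G).
exists G; split=> //; apply: le_trans fZ _; apply: f_mono => //.
  by apply: convex_bigcap => a /= aG; apply: cF; exact: (fsubsetP GF).
by move=> x Zx a /= aG; apply: ZP Zx; exact: Gpiv.
Qed.

(** Helly number 0, applied to the family consisting of the empty set alone,
    forces [f] of the whole space to be smaller than 1, so that the empty
    subfamily never counts. *)
Lemma fractional_helly_number0 (eps eta : R) : f set0 = 0%E -> eta < 1 ->
  helly_number f eta 0 -> fractional_helly_number f eps 0.
Proof.
move=> f0 eta1 fH alpha alpha0; exists 1 => // F _ _.
have fT : (f (inter fset0) < 1)%E.
  rewrite ltNge; apply/negP => fT.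
  have cF : convex_family [fset (set0 : set 'rV[R]_d)]%fset.
    by move=> X; rewrite inE => /eqP ->; exact: convex_set0.
  have : (((1 - eta) * 1)%:E <= f (inter [fset (set0 : set 'rV[R]_d)]%fset))%E.
    by apply: fH => // G _; rewrite leqn0 cardfs_eq0 => /eqP ->.
  rewrite (_ : inter _ = set0); last first.
    by apply/seteqP; split=> // x; apply => /=; rewrite inE.
  by rewrite f0 lee_fin; lra.
rewrite (_ : [fset G in _ | _]%fset = fset0) ?cardfs0 ?bin0 ?mulr1.
  by lra.
apply/fsetP => G; rewrite !inE; apply/negP => /andP[_ /andP[]].
by rewrite cardfs_eq0 => /eqP ->; rewrite leNgt fT.
Qed.

End Helly.

(** * The fractional Helly property *)

Section FractionalHelly.
Variables (R : realType) (d : nat) (f : set 'rV[R]_d -> \bar R).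
Hypotheses (f_wd : well_defined f) (f_mono : Defs.monotone f)
  (f_cont : continuous_on_convex f).
Implicit Types (F B A : {fset set 'rV[R]_d}) (a b C Z : set 'rV[R]_d).

Lemma convex_inter F A :
  convex_family F -> (A `<=` F)%fset -> is_convex (inter A).
Proof.
move=> cF /fsubsetP AF; apply: convex_bigcap => a /= aA; apply: cF; exact: AF.
Qed.

Lemma inter_fsubset A B : (B `<=` A)%fset -> inter A `<=` inter B.
Proof. by move=> /fsubsetP BA x xA a /= /BA; exact: xA. Qed.

Lemma inter_fsetU1 a B : inter (a |` B)%fset = a `&` inter B.
Proof.
apply/seteqP; split=> x.
  move=> xaB; split=> [|b /= bB]; apply: xaB => /=; rewrite !inE ?eqxx//.
  by rewrite bB orbT.
by move=> [ax xB] b /=; rewrite !inE => /orP[/eqP ->|/xB].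
Qed.

(** If [f] is at least 1 on points, then [1 <= f C] says that [C] is nonempty,
    and this is the fractional Helly theorem for nonempty intersections.  The
    sets of the family need not be closed, so each is replaced by the polytope
    spanned by one point of every large intersection in which it takes part.
    The intersection of the polytopes of [B] has a unique point [p B] nearest
    to the origin, and every set pivotal over [B] contains it. *)
Lemma fractional_of_large_points k (eps eta : R) :
  0 < eps -> eta < 1 -> (forall p, (1 <= f [set p])%E) ->
  helly_number f eta k.+1 -> fractional_helly_number f eps k.+1.
Proof.
move=> eps0 eta1 fp fH; apply: fractional_of_pivotal => // F cF.
have f_neq0 C : (0 < f C)%E -> C !=set0.
  by move=> fC; apply/set0P/eqP => C0; move: fC; rewrite C0 f_wd.1 ltxx.
have f_ge1 C p : is_convex C -> C p -> (1 <= f C)%E.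
  move=> cC Cp; apply: le_trans (fp p) _; apply: f_mono => //.
    exact: convex_set1.
  by move=> _ ->.
have [w wP] : {w : {fset set 'rV[R]_d} -> 'rV[R]_d & forall G,
    (1 <= f (inter G))%E -> inter G (w G)}.
  apply: (@choice _ _ (fun G p => (1 <= f (inter G))%E -> inter G p)) => G.
  have [fG|_] := boolP (1 <= f (inter G))%E; last by exists 0.
  by have [|p] := f_neq0 (inter G); [exact: lt_le_trans fG|exists p].
have [h hP] : {h : set 'rV[R]_d -> set 'rV[R]_d & forall a, a \in F ->
    [/\ closed (h a), is_convex (h a), h a `<=` a & forall G, (G `<=` F)%fset ->
      a \in G -> (1 <= f (inter G))%E -> h a (w G)]}.
  apply: (@choice _ _ (fun a P => a \in F ->
    [/\ closed P, is_convex P, P `<=` a & forall G, (G `<=` F)%fset ->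
      a \in G -> (1 <= f (inter G))%E -> P (w G)])) => a.
  pose s := [seq w G | G <- fpowerset F & (a \in G) && (1 <= f (inter G))%E].
  have [P [compP cP sP PA]] := exists_polytope s; exists P => aF; split=> //.
  - apply: compact_closed compP; exact: norm_hausdorff.
  - apply: PA; first exact: cF.
    move=> _ /mapP[G + ->]; rewrite mem_filter => /andP[/andP[aG /wP wG] _].
    exact: wG.
  - move=> G GF aG fG; apply: sP; apply/mapP; exists G => //.
    by rewrite mem_filter aG fG fpowersetE.
pose K B := \bigcap_(b in [set` B]) h b.
have cK B : (B `<=` F)%fset -> is_convex (K B).
  by move=> /fsubsetP BF; apply: convex_bigcap => b /= /BF/hP[].
have KS A B : (B `<=` A)%fset -> K A `<=` K B.
  by move=> /fsubsetP BA x xA b /= /BA; exact: xA.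
have Kw A : (A `<=` F)%fset -> (1 <= f (inter A))%E -> K A (w A).
  by move=> AF fA b /= bA; have [_ _ _] := hP b (fsubsetP AF _ bA); apply.
have [p pP] : {p : {fset set 'rV[R]_d} -> 'rV[R]_d & forall B,
    (B `<=` F)%fset -> K B !=set0 ->
    K B (p B) /\ forall z, K B z -> sqnorm (p B) <= sqnorm z}.
  apply: (@choice _ _ (fun B p => (B `<=` F)%fset -> K B !=set0 ->
    K B p /\ forall z, K B z -> sqnorm p <= sqnorm z)) => B.
  have [[BF K0]|nBF] := pselect ((B `<=` F)%fset /\ K B !=set0); last first.
    by exists 0 => BF K0; exfalso; exact: nBF.
  have [|p Kp minp] := closed_min_sqnorm _ K0; last by exists p.
  by apply: closed_bigI => b /= bB; have [] := hP b (fsubsetP BF _ bB).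
exists (fun B => sqnorm (p B)) => B a0 _; exists [set p B]; split.
- exact: convex_set1.
- by apply: le_trans (fp _); rewrite lee_fin; lra.
move=> a [AF Ak fA aB maxB] _ ->; set A := (a |` B)%fset in AF Ak fA maxB.
have BA : (B `<=` A)%fset by exact: fsubsetU1.
have BF : (B `<=` F)%fset by exact: fsubset_trans AF.
have aA : a \in A by rewrite !inE eqxx.
have [KpB minpB] := pP B BF (ex_intro _ (w A) (KS _ _ BA _ (Kw _ AF fA))).
have : (0 < f (K A `&` sqball (sqnorm (p B))))%E.
  apply: (@lt_le_trans _ _ (1 - eta)%:E); first by rewrite lte_fin subr_gt0.
  apply: (helly_add_set f_mono fH Ak).
  - by move=> i /(fsubsetP AF)/hP[].
  - exact: convex_sqball.
  - apply: (f_ge1 _ (w A)); first exact: cK.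
    exact: Kw.
  - move=> b bA; have AbF : (A `\ b `<=` F)%fset.
      exact: fsubset_trans (fsubsetDl _ _) AF.
    have [|KpAb _] := pP _ AbF.
      by exists (w A); apply: (KS A); [exact: fsubsetDl|exact: Kw].
    apply: (f_ge1 _ (p (A `\ b)%fset)); last by split=> //; exact: maxB.
    by apply: convex_setI; [exact: cK|exact: convex_sqball].
(* A point of [K B] no farther from the origin than [p B] is [p B] itself. *)
move=> /f_neq0[z [KAz zpB]].
rewrite -(@sqnorm_min_unique _ _ (K B) (p B) z) //; first last.
- exact: (KS A).
- exact: cK.
by have [_ _ + _] := hP a (fsubsetP AF _ aA); apply; exact: KAz.
Qed.

(** If [f] is smaller than 1 on points, [t B] can be chosen such that the
    truncation [K] of [inter B] at radius [t B] has value exactly 1.  The Helly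
    property gives [1 - eta <= f (a `&` K)] for every [a] pivotal over [B], so
    all of these sets contain the floating body of [K]. *)
Lemma fractional_of_small_points k (eps eta D : R) :
  D <= eps -> (forall p, (f [set p] < 1)%E) ->
  helly_number f eta k.+1 -> has_floating_bodies f eta D ->
  fractional_helly_number f eps k.+1.
Proof.
move=> Deps fp fH float; apply: fractional_of_pivotal => // F cF.
have [t tP] : {t : {fset set 'rV[R]_d} -> R & forall B, (B `<=` F)%fset ->
    (1 <= f (inter B))%E -> f (inter B `&` sqball (t B)) = 1%E}.
  apply: (@choice _ _ (fun B t => (B `<=` F)%fset -> (1 <= f (inter B))%E ->
    f (inter B `&` sqball t) = 1%E)) => B.
  have [[BF fB]|nBF] := pselect ((B `<=` F)%fset /\ (1 <= f (inter B))%E).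
    have cB := convex_inter cF BF.
    have [r fr] := exists_unit_truncation f_wd f_mono f_cont fp cB fB.
    by exists r.
  by exists 0 => BF fB; exfalso; exact: nBF.
have fsub A B : (A `<=` F)%fset -> (B `<=` A)%fset -> (1 <= f (inter A))%E ->
    (1 <= f (inter B))%E.
  move=> AF BA fA; apply: le_trans fA _.
  apply: f_mono; last exact: inter_fsubset.
    exact: convex_inter cF AF.
  by apply: convex_inter cF _; exact: fsubset_trans AF.
exists t => B a0 [A0F _ fA0 _ _]; pose K := inter B `&` sqball (t B).
have BF : (B `<=` F)%fset by apply: fsubset_trans A0F; exact: fsubsetU1.
have fK : f K = 1%E by apply: tP => //; apply: fsub fA0 => //; exact: fsubsetU1.
have cK : is_convex K.
  by apply: convex_setI; [exact: convex_inter cF BF|exact: convex_sqball].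
have [|Z [cZ fZ ZP]] := float K cK; first by rewrite fK ltry.
exists Z; split=> //.
  by apply: le_trans fZ; rewrite fK mule1 lee_fin; lra.
move=> a [AF Ak fA aB maxB]; apply: ZP.
  by apply: cF; apply: (fsubsetP AF); rewrite !inE eqxx.
rewrite fK mule1 /K setIA -inter_fsetU1.
apply: (helly_add_set (h := id) f_mono fH Ak).
- by move=> i /(fsubsetP AF)/cF.
- exact: convex_sqball.
- exact: fA.
move=> b bA; set A := (a |` B)%fset in AF Ak fA maxB bA *.
have AbF : (A `\ b `<=` F)%fset by exact: fsubset_trans (fsubsetDl _ _) AF.
have cAb : is_convex (inter (A `\ b)%fset) by exact: convex_inter cF AbF.
have fAb := tP _ AbF (fsub _ _ AF (fsubsetDl _ _) fA).
rewrite -fAb; apply: f_mono.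
- by apply: convex_setI => //; exact: convex_sqball.
- by apply: convex_setI => //; exact: convex_sqball.
- by move=> x [xA xt]; split=> //; apply: sqballW xt; exact: maxB.
Qed.

Lemma fractional_of_helly_floating (delta : R -> R) (eps eta : R) (H : nat) :
  floating_body f delta -> 0 < eps < 1 -> 0 < eta < 1 -> delta eta <= eps ->
  helly_number f eta H -> fractional_helly_number f eps H.
Proof.
move=> [float _] /andP[eps0 eps1] eta01 Deps.
have eta1 : eta < 1 by case/andP: eta01.
case: H => [|k] fH; first exact: fractional_helly_number0 f_wd.1 eta1 fH.
have [_ {}float] := float _ eta01.
have D1 := le_lt_trans Deps eps1.
have [large|small] := points_dichotomy f_wd f_cont eta01 D1 float.
  exact: fractional_of_large_points fH.
exact: fractional_of_small_points Deps small fH float.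
Qed.

End FractionalHelly.

Theorem lemma3p4 (R : realType) (d : nat) (f : set 'rV[R]_d -> \bar R)
    (delta : R -> R)
    (f_nonneg : nonneg_on_convex f)
    (f_wd : well_defined f)
    (f_cont : continuous_on_convex f)
    (f_mono : strictly_monotone f)
    (f_helly : admits_helly f)
    (f_float : floating_body f delta) :
  admits_fractional_helly f /\
  forall (eps eta : R) (H : nat), 0 < eps < 1 -> 0 < eta < 1 ->
    delta eta = eps -> helly_number f eta H ->
    exists2 k : nat, (k <= H)%N & fractional_helly_number f eps k.
Proof.
have main := fractional_of_helly_floating f_wd f_mono.1 f_cont f_float.
split=> [eps eps01|eps eta H eps01 eta01 deltaE fH]; last first.
  by exists H => //; apply: main fH => //; rewrite deltaE.
have eps0 : 0 < eps by case/andP: eps01.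
have [eta [eta01 Deps]] : exists eta, 0 < eta < 1 /\ delta eta <= eps.
  have small : \forall eta \near (0 : R)^'+, `|0 - delta eta| < eps.
    by have /cvgrPdist_lt/(_ _ eps0) := f_float.2.
  have : \forall eta \near (0 : R)^'+,
      0 < eta /\ eta < 1 /\ `|0 - delta eta| < eps.
    apply: filterI; first exact: nbhs_right_gt.
    by apply: filterI => //; exact: nbhs_right_lt.
  case/filter_ex => eta [eta0 [eta1 Deta]].
  exists eta; rewrite eta0 eta1; split=> //; apply: le_trans (ltW Deta).
  by rewrite sub0r normrN ler_norm.
have [H fH] := f_helly _ eta01.
by exists H; exact: main eps01 eta01 Deps fH.
Qed.
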